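(* If $S_k\subseteq\mathbb{R}_+$ ($k=1,2,\dots$) are Lebesgue measurable and essentially unbounded in the measure sense, then for almost all $\eta\in\mathbb{R}_+$ and each $k\in\mathbb{N}$ there exists an unbounded subset $\mathbb{J}^k_\eta$ of $\mathbb{Q}_+$ with $$\{q\eta : q\in\mathbb{J}^k_\eta\}\subset S_k .$$
   Context: $\mathbb{R}_+=(0,\infty)$ and $\mathbb{Q}_+$ is the set of positive rationals. A measurable set $S$ is essentially unbounded in the measure sense if for each $m\in\mathbb{N}$ the set $S\setminus(-m,m)$ has positive Lebesgue measure. ''Almost all'' is with respect to Lebesgue measure. *)

(* Defs.v *)
From HB Require Import structures.
From mathcomp Require Import all_boot all_order all_algebra.
From mathcomp Require Import all_classical all_reals all_analysis.

Set Implicit Arguments.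
Unset Strict Implicit.
Unset Printing Implicit Defensive.

Import Order.TTheory GRing.Theory Num.Theory.

Local Open Scope classical_set_scope.
Local Open Scope ring_scope.

(* The sigma-algebra on which [completed_lebesgue_measure] is a measure: the
   Lebesgue measurable sets, as opposed to the Borel sets on which
   [lebesgue_measure] is one. *)
Definition lebesgue_measurable (R : realType) : set (set R) :=
  (@wlength R idfun)^*%mu.-cara.-measurable.

Definition ess_unbounded (R : realType) (S : set R) : Prop :=
  forall m : nat,
    (0 < completed_lebesgue_measure (S `\` `](- m%:R)%R, m%:R%R[))%E.

Definition pos_reals (R : realType) : set R := [set x | 0 < x].

Definition pos_rats : set rat := [set q | 0 < q].

(* Main.v *)
Require Import Defs.
From mathcomp Require Import all_boot all_order all_algebra.
From mathcomp Require Import all_classical all_reals all_analysis.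
From mathcomp Require Import measurable_realfun ring lra.

Import Order.TTheory GRing.Theory Num.Theory.
Import numFieldNormedType.Exports.

Local Open Scope classical_set_scope.
Local Open Scope ring_scope.

(** The group of positive rationals is dense in the multiplicative group of
positive reals, and so it acts ergodically on it by dilation: if $B$ has
positive measure, then almost every $\eta > 0$ has a rational multiple in $B$
([ae_exists_rat_dilation]).  Apply this to the sets $S_k \setminus (-m, m)$ for
all $k$ and $m$.  Outside a countable union of null sets, $\eta$ has for every
$k$ and $m$ a multiple $q\eta \in S_k$ with $q\eta \ge m$; since $\eta$ is fixed,
$q \ge m / \eta$ is as large as desired, and the set of all positive rational
$q$ with $q\eta \in S_k$ is unbounded.

Ergodicity rests on a multiplicative form of Steinhaus' theorem
([exists_rat_dilation]): for two sets $A$ and $B$ of positive measure, some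
rational dilate of $A$ meets $B$.  Let $a$ and $b$ be density points of $A$ and
$B$, and let $q$ be rational and very close to $b / a$.  Dilation by $q$ turns
the small interval around $a$ into an interval that nearly coincides with an
interval around $b$ of the same length.  The sets $qA$ and $B$ each fill more
than three quarters of their interval, so that they cannot be disjoint.  If
the set of $\eta > 0$ without a rational multiple in $B$ had positive measure,
it would itself contradict this.

The $S_k$ are only Lebesgue measurable; [borel_core] replaces each
$S_k \setminus (-m, m)$ by a Borel subset of positive measure, so that the
rest of the argument takes place among Borel sets. *)

(** By uniqueness of Lebesgue measure it is enough to compare the two sides, as
measures in $A$, on half-open intervals. *)
Lemma lebesgue_measure_dilation (R : realType) (c : R) (A : set R) :
  0 < c -> measurable A ->
  lebesgue_measure A = (c%:E * lebesgue_measure ( *%R c @^-1` A))%E.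
Proof.
move=> c0 mA.
have -> : (c%:E * lebesgue_measure ( *%R c @^-1` A))%E =
    mscale (NngNum (ltW c0)) (pushforward lebesgue_measure
      ( *%R c : measurableTypeR R -> measurableTypeR R)) A by [].
apply: lebesgue_measure_unique => //= _ [[a b]] _ <-.
rewrite /mscale/= /pushforward.
have -> : *%R c @^-1` `]a, b] = `]a / c, b / c]%classic.
  apply/seteqP; split=> x /=; rewrite !in_itv/=;
    by rewrite ltr_pdivrMr// ler_pdivlMr// (mulrC x).
rewrite !lebesgue_measure_itv/= !lte_fin ltr_pM2r ?invr_gt0//.
case: ifPn => _; last by rewrite mule0.
by rewrite -!EFinB -EFinM -mulrBl mulrC divfK// gt_eqF.
Qed.

(** Almost all points of $A$ are density points, so a set of positive measure
has one.  The bound is three quarters of the length $2r$ of the ball; any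
proportion below 1 would do, and one above 1/2 makes two such sets meet. *)
Lemma exists_density_point (R : realType) (A : set R) :
  measurable A -> (0 < lebesgue_measure A)%E ->
  exists2 x, A x & exists2 d : R, 0 < d & forall r : R, 0 < r < d ->
    ((3 / 2 * r)%:E < lebesgue_measure (A `&` ball x r))%E.
Proof.
move=> mA A0; apply: contrapT => noP.
have : lebesgue_measure A = 0%E.
  apply: measure_negligible => //; have [N [mN N0 subN]] := lebesgue_density mA.
  exists N; split => // x Ax; apply: subN => /= cvgx.
  apply: noP; exists x => //.
  have x34 : ((3 / 4)%:E < (\1_A x : R)%:E)%E.
    by rewrite indicE mem_set//= lte_fin; lra.
  have /cvgx[d /= d0 dP] : nbhs (\1_A x : R)%:E [set y | ((3 / 4)%:E < y)%E].
    by apply: open_nbhs_nbhs; split => //; exact: open_ereal_gt_ereal.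
  exists d => // r /andP[r0 rd].
  have := dP r; rewrite /= sub0r normrN gtr0_norm// => /(_ rd r0).
  rewrite lebesgue_measure_ball ?ltW// inver mulrn_eq0/= gt_eqF//.
  rewrite lte_pdivlMr ?mulrn_wgt0// -EFinM.
  by congr (_%:E < _)%E; lra.
by move=> muA0; rewrite muA0 ltxx in A0.
Qed.

(** A multiplicative Steinhaus theorem.  If no rational dilate of $A$ met $B$,
then for $q$ close to $b / a$ the parts of $qA$ and of $B$ near $b$ would be
disjoint, lie in a common ball of radius $3qr/2$, hence of measure $3qr$, and
yet have measure more than $3qr/2$ each. *)
Lemma exists_rat_dilation (R : realType) (A B : set R) :
  A `<=` @pos_reals R -> measurable A -> (0 < lebesgue_measure A)%E ->
  B `<=` @pos_reals R -> measurable B -> (0 < lebesgue_measure B)%E ->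
  exists (q : rat), exists2 x, A x & B (ratr q * x).
Proof.
move=> Apos mA A0 Bpos mB B0; apply: contrapT => noq.
have [a Aa [dA dA0 densA]] := exists_density_point _ _ mA A0.
have [b Bb [dB dB0 densB]] := exists_density_point _ _ mB B0.
have a0 : 0 < a := Apos _ Aa; have b0 : 0 < b := Bpos _ Bb.
have [s s0 sa] : exists2 s : R, 0 < s & s * a = b.
  by exists (b / a); rewrite ?divr_gt0// divfK// gt_eqF.
(* The dilation factor [c] chosen below is less than [2 * s], so the radius
   [c * r] around [b] stays below [dB]. *)
have [r /andP[r0 rA] rB] : exists2 r : R, 0 < r < dA & 2 * s * r < dB.
  pose m := Num.min dA (dB / (2 * s)).
  have m0 : 0 < m by rewrite lt_min dA0 divr_gt0// mulr_gt0.
  have mA' : m <= dA by rewrite ge_min lexx.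
  have mB' : m * (2 * s) <= dB.
    by rewrite -ler_pdivlMr ?mulr_gt0// ge_min lexx orbT.
  exists (m / 2); first by apply/andP; split; lra.
  nra.
(* The second upper bound makes the dilated centre [c * a] fall within half of
   the radius [c * r] from [b]. *)
have [q] : exists q : rat,
    ratr q \in `]s, Num.min (2 * s) (s + s * r / (2 * a))[.
  apply: rat_in_itvoo; rewrite lt_min; apply/andP; split; first lra.
  by rewrite ltrDl divr_gt0 ?mulr_gt0.
rewrite in_itv/= lt_min; set c : R := ratr q => /and3P[sc c2s csr].
have c0 : 0 < c by lra.
have cab : c * a - b < c * r / 2.
  have : (c - s) * a < s * r / 2.
    rewrite -ltr_pdivlMr// (_ : _ / a = s * r / (2 * a)); first lra.
    by rewrite invfM; ring.
  rewrite mulrBl sa; nra.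
have bca : b < c * a by rewrite -sa ltr_pM2r.
(* [X] is the dilate of [A `&` ball a r] by [c]. *)
pose X := *%R c^-1 @^-1` (A `&` ball a r).
pose Y := B `&` ball b (c * r).
have mX : measurable X.
  rewrite -[X in measurable X]setTI; apply: mulrl_measurable => //.
  by apply: measurableI => //; exact: measurable_ball.
have mY : measurable Y by apply: measurableI => //; exact: measurable_ball.
have muX : ((3 / 2 * (c * r))%:E < lebesgue_measure X)%E.
  rewrite (lebesgue_measure_dilation _ _ _ c0 mX).
  rewrite (_ : _ @^-1` X = A `&` ball a r); last first.
    rewrite /X -comp_preimage.
    by apply/seteqP; split=> x /=; rewrite mulKf ?gt_eqF.
  rewrite mulrCA EFinM lte_pmul2l//; apply: densA; exact/andP.
have muY : ((3 / 2 * (c * r))%:E < lebesgue_measure Y)%E.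
  by apply: densB; rewrite mulr_gt0//=; nra.
have XY0 : X `&` Y = set0.
  apply/seteqP; split => // y [[Ay _] [By _]]; apply: noq.
  by exists q, (c^-1 * y) => //; rewrite -/c mulVKf ?gt_eqF.
have XYsub : X `|` Y `<=` ball b (3 / 2 * (c * r)).
  have cr0 : 0 < c * r by rewrite mulr_gt0.
  rewrite /X /Y !ball_itv => y [[_]|[_]] /=; rewrite !in_itv/=; last first.
    by move=> /andP[? ?]; apply/andP; split; lra.
  by rewrite ltr_pdivlMl// ltr_pdivrMl// => /andP[? ?]; apply/andP; split; lra.
have rad0 : 0 <= 3 / 2 * (c * r) by have := mulr_gt0 c0 r0; lra.
have : (lebesgue_measure X + lebesgue_measure Y <=
    (3 / 2 * (c * r) *+ 2)%:E)%E.
  rewrite -(lebesgue_measure_ball b)// -measureU// le_measure ?inE//.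
    exact: measurableU.
  exact: measurable_ball.
by apply/negP; rewrite -ltNge mulr2n EFinD lteD.
Qed.

(** A Lebesgue measurable set is a Borel set [B] together with a subset of a
Borel null set [M]; if [B] were null, the outer measure of the whole would be
at most that of [B `|` M], which vanishes. *)
Lemma borel_core (R : realType) (S : set R) :
  lebesgue_measurable S -> (0 < completed_lebesgue_measure S)%E ->
  exists B : set R,
    [/\ measurable B, B `<=` S & (0 < lebesgue_measure B)%E].
Proof.
rewrite /lebesgue_measurable -completed_caratheodory_measurable.
rewrite g_sigma_completed_algebra_genE => -[B mB [N [M [mM M0 NM]]] <-] S0.
exists B; split => //.
rewrite lt0e measure_ge0 andbT; apply/eqP => B0.
move: S0; rewrite lt_neqAle => /andP[/eqP + _]; apply; apply/esym/eqP.
rewrite eq_le measure_ge0 andbT.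
have <- : lebesgue_measure (B `|` M) = 0%E.
  by rewrite measureU0.
apply: le_outer_measure; exact: setUS.
Qed.

(** The exceptional set [E] is Borel and no rational dilate of it meets [B]; by
[exists_rat_dilation] it cannot have positive measure. *)
Lemma ae_exists_rat_dilation (R : realType) (B : set R) :
  measurable B -> B `<=` @pos_reals R -> (0 < lebesgue_measure B)%E ->
  {ae @completed_lebesgue_measure R, forall x : R,
    pos_reals x -> exists2 q : rat, 0 < q & B (ratr q * x)}.
Proof.
move=> mB Bpos B0.
pose E := [set x : R | 0 < x] `\` \bigcup_q ( *%R (ratr q) @^-1` B).
have mE : measurable E.
  apply: measurableD; last apply: bigcupT_measurable_rat => q.
    by rewrite -set_itvoy; exact: measurable_itv.
  rewrite -[X in measurable X]setTI; exact: mulrl_measurable.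
exists E; split.
- exact: sub_caratheodory.
(* Both measures are restrictions of the same outer measure. *)
- change (lebesgue_measure E = 0%E); apply/eqP; apply: contraT.
  rewrite -measure_gt0 => E0.
  have Epos : E `<=` @pos_reals R by move=> x [].
  have [q [x [_ noq] Bqx]] := exists_rat_dilation _ _ _ Epos mE E0 Bpos mB B0.
  by case: noq; exists q.
- move=> x /= /not_implyP[x0 noq]; split => //= -[q _ Bqx].
  apply: noq; exists q => //.
  by have := Bpos _ Bqx; rewrite /pos_reals/= pmulr_lgt0// ltr0q.
Qed.

Theorem theorem3 (R : realType) (S : nat -> set R)
    (Spos : forall k, S k `<=` @pos_reals R)
    (Smeas : forall k, lebesgue_measurable (S k))
    (Sunb : forall k, ess_unbounded (S k)) :
  {ae @completed_lebesgue_measure R, forall eta : R,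
    pos_reals eta ->
    forall k, exists J : set rat,
      [/\ J `<=` pos_rats,
          ~ has_ubound J &
          [set ratr q * eta | q in J] `<=` S k]}.
Proof.
have aeF := ae_filter_ringOfSetsType (@completed_lebesgue_measure R).
have hit k m : {ae @completed_lebesgue_measure R, forall x : R,
    pos_reals x -> exists2 q : rat, 0 < q &
      (S k `\` `](- m%:R)%R, m%:R[) (ratr q * x)}.
  have [||B [mB BS B0]] := borel_core _ (S k `\` `](- m%:R)%R, m%:R[).
  - apply: measurableD; first exact: Smeas.
    by apply: sub_caratheodory; exact: measurable_itv.
  - exact: Sunb.
  have Bpos : B `<=` @pos_reals R by move=> x /BS[/Spos].
  apply: filterS (ae_exists_rat_dilation _ _ mB Bpos B0) => x + x0.
  by move=> /(_ x0)[q q0 /BS]; exists q.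
have := ae_foralln (fun k => ae_foralln (hit k)).
apply: filterS => eta hit_eta eta0 k.
exists [set q | 0 < q /\ S k (ratr q * eta)]; split.
- by move=> q [].
- move=> [u ubu].
  (* A multiple of [eta] in [S k] beyond [ratr u * eta] has a factor beyond [u];
     the absolute value is there because [u] may be negative. *)
  have [q q0 [Sq]] := hit_eta k (Num.bound `|ratr u * eta|) eta0.
  apply; rewrite /= in_itv/=; apply/andP; split.
    by apply: (le_lt_trans _ (Spos k _ Sq)); rewrite oppr_le0.
  apply: (le_lt_trans _ (archi_boundP (normr_ge0 (ratr u * eta)))).
  apply: (le_trans _ (ler_norm _)).
  by rewrite ler_pM2r// ler_rat; apply: ubu.
- by move=> _ [q [_ Sq]] <-.
Qed.
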